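(* Let $(\lambda,\lambda')$ be a regular pair of weights, $\lambda=(x,y)$, $\lambda'=(x',y')$. Define $\mathbf F_{\lambda,\lambda'}:\mathbb C^N\otimes\mathbb C^N\to\mathbb C^N\otimes\mathbb C^N$ by $$\mathbf F_{\lambda,\lambda'}:=(B_2)^{-m_{x,x'}}\circ\mathbf S\circ\Phi^q_{\mathbf a,\mathbf c}(B_1A_2B_2^{-1}),\qquad \mathbf a=-\frac{y^{1/N}(x')^{1/N}}{(yx'+y')^{1/N}},\quad \mathbf c=\frac{(y')^{1/N}}{(yx'+y')^{1/N}},$$ where $\mathbf S$ is the linear map with $\mathbf S(e_i\otimes e_j)=e_i\otimes e_{i+j}$ for all $i,j$, and $A_1=A\otimes\mathrm{id}$, $B_1=B\otimes\mathrm{id}$, $A_2=\mathrm{id}\otimes A$, $B_2=\mathrm{id}\otimes B$. Then $\mathbf F_{\lambda,\lambda'}$ is invertible and provides a $\mathcal W$-intertwining map $$\mathbf F_{\lambda,\lambda'}:V_\lambda\otimes V_{\lambda'}\to M^{\lambda\lambda'}_{\lambda,\lambda'}\otimes V_{\lambda\lambda'},$$ i.e. $\mathbf F_{\lambda,\lambda'}(W.(v\otimes v'))=(\mathrm{id}\otimes W).\mathbf F_{\lambda,\lambda'}(v\otimes v')$ for all $W\in\mathcal W$, $v\in V_\lambda$, $v'\in V_{\lambda'}$.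
   Context: $N$ is a fixed odd positive integer, $q=e^{\pi\sqrt{-1}/N}$. $\mathcal W$ is the Hopf algebra over $\mathbb C$ generated by $X^{\pm1},Y$ with $XY=q^2YX$, $\Delta X=X\otimes X$, $\Delta Y=Y\otimes X+1\otimes Y$, $\epsilon(X)=1$, $\epsilon(Y)=0$, $S(X)=X^{-1}$, $S(Y)=-YX^{-1}$. Representations are finite dimensional complex left $\mathcal W$-modules; tensor products are formed via $\Delta$; a representation is trivial if each $W$ acts by $\epsilon(W)\,\mathrm{id}$. $e_0,\dots,e_{N-1}$ is the standard basis of $\mathbb C^N$, indices mod $N$; $Ae_k=q^{2k}e_k$, $Be_k=e_{k+1}$. For each $z\in\mathbb C^\times$ an $N$-th root $z^{1/N}$ is fixed, with $1^{1/N}=1$, $(z^{1/N})^{-1}=(z^{-1})^{1/N}=:z^{-1/N}$, $(-z)^{1/N}=-z^{1/N}$; $m_{z,w}\in\{0,\dots,N-1\}$ is defined by $(zw)^{1/N}=q^{2m_{z,w}}z^{1/N}w^{1/N}$. A weight is a pair $\lambda=(x,y)\in\mathbb C^2$, non-singular if $x,y\neq0$. Product: $(x,y)(x',y')=(xx',yx'+y')$. For non-singular $\lambda=(x,y)$, $V_\lambda$ is $\mathbb C^N$ with $X$ acting by $x^{1/N}A$, $Y$ by $y^{1/N}B$. A pair $(\lambda,\lambda')$ of non-singular weights is regular if $X$ and $Y$ act invertibly on $V_\lambda\otimes V_{\lambda'}$ (equivalently $\lambda\lambda'$ is also non-singular). $M^{\lambda\lambda'}_{\lambda,\lambda'}$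 denotes $\mathbb C^N$ as a trivial representation of $\mathcal W$. Cyclic quantum dilogarithm: for $\mathbf a,\mathbf c\in\mathbb C$ with $\mathbf c^N-\mathbf a^N=1$ put $w(\mathbf a,\mathbf c|0)=1$, $w(\mathbf a,\mathbf c|n)=\prod_{j=1}^n(\mathbf c-\mathbf a q^{2j})^{-1}$ ($N$-periodic in $n$). For an operator $C$ on a complex vector space with $C^N=\mathrm{id}$, $\Phi^q_{\mathbf a,\mathbf c}(C)$ acts on the $q^{2i}$-eigenspace of $C$ by the scalar $\zeta_{\mathbf a,\mathbf c}\,w(\mathbf a,\mathbf c|i)$, where $\zeta_{\mathbf a,\mathbf c}$ is a fixed nonzero complex constant. *)

(* Defs.v *)
From HB Require Import structures.
From mathcomp Require Import all_boot all_order all_algebra.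
From mathcomp Require Import boolp classical_sets reals trigo.
From mathcomp Require Import complex mxtens ring.

Set Implicit Arguments.
Unset Strict Implicit.
Unset Printing Implicit Defensive.

Import Order.TTheory GRing.Theory Num.Theory.
Local Open Scope ring_scope.
Local Open Scope quotient_scope.

(* The algebra W over K generated by X, X^-1, Y subject to X X^-1 = X^-1 X = 1 *)
(* and X Y = q^2 Y X, as the quotient of noncommutative polynomial expressions *)
(* by the least congruence containing the K-algebra axioms and the relations.  *)
Section Presentation.
Variables (K : fieldType) (q : K).

Inductive wterm : Type :=
  | TX | TXV | TY | TC of K | TD of wterm & wterm | TM of wterm & wterm.

HB.instance Definition _ := gen_eqMixin wterm.
HB.instance Definition _ := gen_choiceMixin wterm.

Inductive wcong : wterm -> wterm -> Prop :=
  | wcong_refl s : wcong s s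
  | wcong_sym s t : wcong s t -> wcong t s
  | wcong_trans s t u : wcong s t -> wcong t u -> wcong s u
  | wcongD s s' t t' : wcong s s' -> wcong t t' -> wcong (TD s t) (TD s' t')
  | wcongM s s' t t' : wcong s s' -> wcong t t' -> wcong (TM s t) (TM s' t')
  | wcongDA s t u : wcong (TD s (TD t u)) (TD (TD s t) u)
  | wcongDC s t : wcong (TD s t) (TD t s)
  | wcong0D s : wcong (TD (TC 0) s) s
  | wcongMA s t u : wcong (TM s (TM t u)) (TM (TM s t) u)
  | wcongMDl s t u : wcong (TM (TD s t) u) (TD (TM s u) (TM t u))
  | wcongMDr s t u : wcong (TM s (TD t u)) (TD (TM s t) (TM s u))
  | wcongCD a b : wcong (TC (a + b)) (TD (TC a) (TC b))
  | wcongCM a b : wcong (TC (a * b)) (TM (TC a) (TC b))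
  | wcongC0 s : wcong (TM (TC 0) s) (TC 0)
  | wcongC1 s : wcong (TM (TC 1) s) s
  | wcongCC a s : wcong (TM (TC a) s) (TM s (TC a))
  | wcongXXV : wcong (TM TX TXV) (TC 1)
  | wcongXVX : wcong (TM TXV TX) (TC 1)
  | wcongXY : wcong (TM TX TY) (TM (TC (q ^+ 2)) (TM TY TX)).

Definition weqb (s t : wterm) : bool := `[< wcong s t >].

Fact weqb_equiv : equiv_class_of weqb.
Proof.
split=> [s|s t|t s u].
- by apply/asboolP; exact: wcong_refl.
- by apply/asboolP/asboolP; exact: wcong_sym.
- by move=> /asboolP st /asboolP tu; apply/asboolP; exact: wcong_trans st tu.
Qed.

Canonical weqb_equivRel := EquivRelPack weqb_equiv.

Definition walg : Type := {eq_quot weqb}.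

HB.instance Definition _ : EqQuotient _ weqb walg := EqQuotient.on walg.
HB.instance Definition _ := Choice.on walg.

Lemma wpiP (s t : wterm) : wcong s t -> \pi_walg s = \pi_walg t.
Proof. by move=> st; apply/(@eqmodP _ weqb_equivRel)/asboolP. Qed.

Lemma wreprP (s : wterm) : wcong (repr (\pi_walg s)) s.
Proof. by apply/asboolP/(@eqmodP _ weqb_equivRel); rewrite reprK. Qed.

Definition wX : walg := \pi_walg TX.
Definition wXV : walg := \pi_walg TXV.
Definition wY : walg := \pi_walg TY.
Definition wC (c : K) : walg := \pi_walg (TC c).
Definition wadd (u v : walg) : walg := \pi_walg (TD (repr u) (repr v)).
Definition wmul (u v : walg) : walg := \pi_walg (TM (repr u) (repr v)).
Definition wopp (u : walg) : walg := wmul (wC (-1)) u.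

Lemma wpiD s t : \pi_walg (TD s t) = wadd (\pi s) (\pi t).
Proof. by apply/wpiP/wcongD; apply/wcong_sym/wreprP. Qed.
Lemma wpiM s t : \pi_walg (TM s t) = wmul (\pi s) (\pi t).
Proof. by apply/wpiP/wcongM; apply/wcong_sym/wreprP. Qed.

Local Ltac wquot :=
  repeat (let t := fresh "t" in elim/quotW => t);
  rewrite /wopp /wC -?(wpiD, wpiM); apply/wpiP; by constructor.

Fact waddA : associative wadd. Proof. wquot. Qed.
Fact waddC : commutative wadd. Proof. wquot. Qed.
Fact wadd0 : left_id (wC 0) wadd. Proof. wquot. Qed.
Fact wmulA : associative wmul. Proof. wquot. Qed.
Fact wmul1l : left_id (wC 1) wmul. Proof. wquot. Qed.
Fact wmulDl : left_distributive wmul wadd. Proof. wquot. Qed.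
Fact wmulDr : right_distributive wmul wadd. Proof. wquot. Qed.
Fact wmulC0 u : wmul (wC 0) u = wC 0. Proof. move: u; wquot. Qed.
Fact wmulCC c u : wmul (wC c) u = wmul u (wC c). Proof. move: u; wquot. Qed.
Fact wC_add a b : wC (a + b) = wadd (wC a) (wC b). Proof. wquot. Qed.
Fact wC_mul a b : wC (a * b) = wmul (wC a) (wC b). Proof. wquot. Qed.
Fact wmul1r : right_id (wC 1) wmul.
Proof. by move=> u; rewrite -wmulCC wmul1l. Qed.
Fact waddN : left_inverse (wC 0) wopp wadd.
Proof.
by move=> u; rewrite /wopp -{2}(wmul1l u) -wmulDl -wC_add addNr wmulC0.
Qed.

HB.instance Definition _ := GRing.isZmodule.Build walg waddA waddC wadd0 waddN.
HB.instance Definition _ := GRing.Zmodule_isPzRing.Build walg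
  wmulA wmul1l wmul1r wmulDl wmulDr.

Lemma wX_XV : wX * wXV = 1. Proof. by rewrite /GRing.mul/= -wpiM; apply/wpiP/wcongXXV. Qed.
Lemma wXV_X : wXV * wX = 1. Proof. by rewrite /GRing.mul/= -wpiM; apply/wpiP/wcongXVX. Qed.

Section Eval.
Variables (A : pzRingType) (h : {rmorphism K -> A}) (x xv y : A).

Fixpoint weval (t : wterm) : A :=
  match t with
  | TX => x | TXV => xv | TY => y | TC c => h c
  | TD s t => weval s + weval t
  | TM s t => weval s * weval t
  end.

(* Evaluation through a representative; a ring morphism as soon as the        *)
(* relations wrels below hold, in which case the representative is irrelevant. *)
Definition wlift (u : walg) : A := weval (repr u).

Definition wrels : Prop :=
  [/\ forall c a, h c * a = a * h c, x * xv = 1, xv * x = 1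
    & x * y = h (q ^+ 2) * (y * x)].

Hypothesis hxy : wrels.

Lemma weval_cong s t : wcong s t -> weval s = weval t.
Proof.
case: hxy => hC xxv xvx xy; elim=> {s t} //=; intros;
  rewrite ?rmorph0 ?rmorph1 ?rmorphD ?rmorphM ?mul0r ?mul1r ?add0r //.
- by etransitivity; eauto.
- by congr (_ + _).
- by congr (_ * _).
- exact: addrA.
- exact: addrC.
- exact: mulrA.
- exact: mulrDl.
- exact: mulrDr.
Qed.

Lemma wlift_pi t : wlift (\pi t) = weval t.
Proof. exact/weval_cong/wreprP. Qed.

Lemma wliftX : wlift wX = x. Proof. exact: wlift_pi. Qed.
Lemma wliftXV : wlift wXV = xv. Proof. exact: wlift_pi. Qed.
Lemma wliftY : wlift wY = y. Proof. exact: wlift_pi. Qed.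
Lemma wliftC c : wlift (wC c) = h c. Proof. exact: wlift_pi. Qed.

Lemma wliftD : {morph wlift : u v / u + v}.
Proof. by elim/quotW=> s; elim/quotW=> t; rewrite /GRing.add/= -wpiD !wlift_pi. Qed.
Lemma wliftM : {morph wlift : u v / u * v}.
Proof. by elim/quotW=> s; elim/quotW=> t; rewrite /GRing.mul/= -wpiM !wlift_pi. Qed.
Lemma wlift1 : wlift 1 = 1.
Proof. by rewrite [LHS]wliftC rmorph1. Qed.
Lemma wlift0 : wlift 0 = 0.
Proof. by rewrite [LHS]wliftC rmorph0. Qed.

End Eval.

Fact walg_counit_rels : @wrels K idfun 1 1 0.
Proof. by split=> [c a|||] //=; rewrite ?mulr1 ?mulr0 // mulrC. Qed.

Fact walg_neq0 : (1 : walg) != 0.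
Proof.
apply/eqP => /(congr1 (@wlift K idfun 1 1 0)).
by rewrite (wlift1 walg_counit_rels) (wlift0 walg_counit_rels); apply/eqP/oner_neq0.
Qed.

HB.instance Definition _ := GRing.PzSemiRing_isNonZero.Build walg walg_neq0.

Definition wscale (c : K) (u : walg) : walg := wC c * u.
Fact wscaleA a b u : wscale a (wscale b u) = wscale (a * b) u.
Proof. by rewrite /wscale mulrA [wC (a * b)]wC_mul. Qed.
Fact wscale1 : left_id 1 wscale. Proof. exact: mul1r. Qed.
Fact wscaleDr : right_distributive wscale +%R.
Proof. by move=> c u v; exact: mulrDr. Qed.
Fact wscaleDl u : {morph wscale^~ u : a b / a + b}.
Proof. by move=> a b; rewrite /wscale [wC _]wC_add; exact: mulrDl. Qed.
HB.instance Definition _ := GRing.Zmodule_isLmodule.Build K walg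
  wscaleA wscale1 wscaleDr wscaleDl.
Fact wscaleAl (c : K) (u v : walg) : c *: (u * v) = (c *: u) * v.
Proof. exact: mulrA. Qed.
HB.instance Definition _ := GRing.Lmodule_isLalgebra.Build K walg wscaleAl.
Lemma wscaleE (c : K) (u : walg) : c *: u = wC c * u. Proof. by []. Qed.
Fact wscaleAr (c : K) (u v : walg) : c *: (u * v) = u * (c *: v).
Proof. by rewrite !wscaleE !mulrA; congr (_ * _); exact: wmulCC. Qed.
HB.instance Definition _ := GRing.Lalgebra_isAlgebra.Build K walg wscaleAr.

Lemma wXY : wX * wY = q ^+ 2 *: (wY * wX).
Proof.
by have := wpiP wcongXY; rewrite !wpiM.
Qed.

End Presentation.

(* The tensor product A (x) B of two K-algebras: formal sums of pairs, two     *)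
(* formal sums being identified when no bilinear map on A x B separates them.  *)
Section TensorProduct.
Variables (K : fieldType) (A B : algType K).

Definition tsum (V : nmodType) (f : A -> B -> V) (s : seq (A * B)) : V :=
  \sum_(p <- s) f p.1 p.2.

Definition tens_eq (s t : seq (A * B)) : Prop :=
  forall (V : lmodType K) (f : A -> B -> V),
    bilinear_for *:%R *:%R f -> tsum f s = tsum f t.

Definition tens_eqb (s t : seq (A * B)) : bool := `[< tens_eq s t >].

Fact tens_eqb_equiv : equiv_class_of tens_eqb.
Proof.
split=> [s|s t|t s u].
- by apply/asboolP.
- by apply/asboolP/asboolP => st V f bf; rewrite st.
- by move=> /asboolP st /asboolP tu; apply/asboolP => V f bf; rewrite st ?tu.
Qed.

Canonical tens_eqb_equivRel := EquivRelPack tens_eqb_equiv.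

Definition tens : Type := {eq_quot tens_eqb}.

HB.instance Definition _ : EqQuotient _ tens_eqb tens := EqQuotient.on tens.
HB.instance Definition _ := Choice.on tens.

Lemma tpiP s t : tens_eq s t -> \pi_tens s = \pi_tens t.
Proof. by move=> st; apply/(@eqmodP _ tens_eqb_equivRel)/asboolP. Qed.

Lemma treprP s : tens_eq (repr (\pi_tens s)) s.
Proof. by apply/asboolP/(@eqmodP _ tens_eqb_equivRel); rewrite reprK. Qed.

Definition tpure (a : A) (b : B) : tens := \pi_tens [:: (a, b)].
Definition tadd (u v : tens) : tens := \pi_tens (repr u ++ repr v).
Definition tscale (c : K) (u : tens) : tens :=
  \pi_tens [seq (c *: p.1, p.2) | p <- repr u].
Definition topp (u : tens) : tens := tscale (-1) u.
Definition tmul (u v : tens) : tens :=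
  \pi_tens [seq (p.1 * r.1, p.2 * r.2) | p <- repr u, r <- repr v].

Section Lift.
Variables (V : lmodType K) (f : A -> B -> V).
Definition tlift (u : tens) : V := tsum f (repr u).
Hypothesis bf : bilinear_for *:%R *:%R f.

Lemma tlift_pi s : tlift (\pi s) = tsum f s.
Proof. exact: treprP. Qed.

Lemma bilD1 a a' b : f (a + a') b = f a b + f a' b.
Proof. by have := bf.1 b 1 a a'; rewrite /= !scale1r. Qed.
Lemma bilD2 a b b' : f a (b + b') = f a b + f a b'.
Proof. by have := bf.2 a 1 b b'; rewrite /= !scale1r. Qed.
Lemma bil01 b : f 0 b = 0.
Proof. by apply: (addrI (f 0 b)); rewrite -bilD1 !addr0. Qed.
Lemma bil02 a : f a 0 = 0.
Proof. by apply: (addrI (f a 0)); rewrite -bilD2 !addr0. Qed.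
Lemma bilZ1 c a b : f (c *: a) b = c *: f a b.
Proof. by have := bf.1 b c a 0; rewrite /= !addr0 bil01 addr0. Qed.
Lemma bilZ2 c a b : f a (c *: b) = c *: f a b.
Proof. by have := bf.2 a c b 0; rewrite /= !addr0 bil02 addr0. Qed.

Lemma tlift_pure a b : tlift (tpure a b) = f a b.
Proof. by rewrite tlift_pi /tsum big_seq1. Qed.

Lemma tliftD u v : tlift (tadd u v) = tlift u + tlift v.
Proof. by rewrite tlift_pi /tsum big_cat. Qed.
Lemma tliftZ c u : tlift (tscale c u) = c *: tlift u.
Proof.
rewrite tlift_pi /tlift /tsum big_map scaler_sumr.
by apply: eq_bigr => p _; rewrite bilZ1.
Qed.
Lemma tlift_repr0 : tlift (\pi [::]) = 0.
Proof. by rewrite tlift_pi /tsum big_nil. Qed.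
Lemma tliftM u v : tlift (tmul u v) =
  \sum_(p <- repr u) \sum_(r <- repr v) f (p.1 * r.1) (p.2 * r.2).
Proof. by rewrite tlift_pi /tsum big_allpairs_dep. Qed.

End Lift.

Lemma tensP (u v : tens) :
  (forall (V : lmodType K) (f : A -> B -> V),
    bilinear_for *:%R *:%R f -> tlift f u = tlift f v) -> u = v.
Proof. by move=> uv; rewrite -[u]reprK -[v]reprK; apply: tpiP. Qed.

Lemma bil_mull (V : lmodType K) (f : A -> B -> V) (p : A * B) :
  bilinear_for *:%R *:%R f ->
  bilinear_for *:%R *:%R (fun a b => f (a * p.1) (b * p.2)).
Proof.
move=> bf; split=> [b|a] c x y /=.
- by rewrite mulrDl -scalerAl bilD1 // bilZ1.
- by rewrite mulrDl -scalerAl bilD2 // bilZ2.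
Qed.

Lemma bil_mulr (V : lmodType K) (f : A -> B -> V) (p : A * B) :
  bilinear_for *:%R *:%R f ->
  bilinear_for *:%R *:%R (fun a b => f (p.1 * a) (p.2 * b)).
Proof.
move=> bf; split=> [b|a] c x y /=.
- by rewrite mulrDr -scalerAr bilD1 // bilZ1.
- by rewrite mulrDr -scalerAr bilD2 // bilZ2.
Qed.

Lemma tliftMl (V : lmodType K) (f : A -> B -> V) u v :
  bilinear_for *:%R *:%R f ->
  tlift f (tmul u v) =
  \sum_(r <- repr v) tlift (fun a b => f (a * r.1) (b * r.2)) u.
Proof. by move=> bf; rewrite tliftM // exchange_big. Qed.

Lemma tliftMr (V : lmodType K) (f : A -> B -> V) u v :
  bilinear_for *:%R *:%R f ->
  tlift f (tmul u v) =
  \sum_(p <- repr u) tlift (fun a b => f (p.1 * a) (p.2 * b)) v.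
Proof. by move=> bf; rewrite tliftM. Qed.

Fact taddA : associative tadd.
Proof. by move=> u v w; apply: tensP => V f bf; rewrite !tliftD // addrA. Qed.
Fact taddC : commutative tadd.
Proof. by move=> u v; apply: tensP => V f bf; rewrite !tliftD // addrC. Qed.
Fact tadd0 : left_id (\pi_tens [::]) tadd.
Proof. by move=> u; apply: tensP => V f bf; rewrite tliftD // tlift_repr0 // add0r. Qed.
Fact taddN : left_inverse (\pi_tens [::]) topp tadd.
Proof.
move=> u; apply: tensP => V f bf.
by rewrite tliftD // tliftZ // tlift_repr0 // scaleN1r addNr.
Qed.

HB.instance Definition _ := GRing.isZmodule.Build tens taddA taddC tadd0 taddN.

Fact tmulA : associative tmul.
Proof.
move=> u v w; apply: tensP => V f bf.
rewrite tliftMr // [RHS]tliftMl //.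
under eq_bigr => p _ do rewrite (tliftMl _ _ (bil_mulr p bf)).
under [RHS]eq_bigr => p _ do rewrite (tliftMr _ _ (bil_mull p bf)).
rewrite exchange_big /=; apply: eq_bigr => r _; apply: eq_bigr => p _.
by congr (tlift _ v); apply/funext => a; apply/funext => b; rewrite !mulrA.
Qed.
Fact tmul1l : left_id (tpure 1 1) tmul.
Proof.
move=> u; apply: tensP => V f bf; rewrite tliftMl // [RHS]/tlift.
by apply: eq_bigr => r _; rewrite tlift_pure ?mul1r //; exact: bil_mull.
Qed.
Fact tmul1r : right_id (tpure 1 1) tmul.
Proof.
move=> u; apply: tensP => V f bf; rewrite tliftMr // [RHS]/tlift.
by apply: eq_bigr => r _; rewrite tlift_pure ?mulr1 //; exact: bil_mulr.
Qed.
Fact tmulDl : left_distributive tmul tadd.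
Proof.
move=> u v w; apply: tensP => V f bf; rewrite tliftD // !tliftMl // -big_split.
by apply: eq_bigr => r _; rewrite tliftD //; exact: bil_mull.
Qed.
Fact tmulDr : right_distributive tmul tadd.
Proof.
move=> u v w; apply: tensP => V f bf; rewrite tliftD // !tliftMr // -big_split.
by apply: eq_bigr => r _; rewrite tliftD //; exact: bil_mulr.
Qed.

HB.instance Definition _ := GRing.Zmodule_isPzRing.Build tens
  tmulA tmul1l tmul1r tmulDl tmulDr.

Fact tscaleA a b u : tscale a (tscale b u) = tscale (a * b) u.
Proof. by apply: tensP => V f bf; rewrite !tliftZ // scalerA. Qed.
Fact tscale1 : left_id 1 tscale.
Proof. by move=> u; apply: tensP => V f bf; rewrite !tliftZ // scale1r. Qed.
Fact tscaleDr : right_distributive tscale +%R.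
Proof.
move=> c u v; apply: tensP => V f bf.
by rewrite [u + v]/(tadd u v) [RHS]tliftD // !tliftZ // tliftD // scalerDr.
Qed.
Fact tscaleDl u : {morph tscale^~ u : a b / a + b}.
Proof.
move=> a b; apply: tensP => V f bf.
by rewrite [RHS]tliftD // !tliftZ // scalerDl.
Qed.
HB.instance Definition _ := GRing.Zmodule_isLmodule.Build K tens
  tscaleA tscale1 tscaleDr tscaleDl.

Lemma tpureM a b a' b' : tpure a b * tpure a' b' = tpure (a * a') (b * b').
Proof.
apply: tensP => V f bf; rewrite [LHS]tliftMl // tlift_pure //.
under eq_bigr => r _ do rewrite (tlift_pure (bil_mull r bf)).
exact: (tlift_pure (bil_mulr (a, b) bf)).
Qed.

Lemma tscaleAl (c : K) (u v : tens) : c *: (u * v) = (c *: u) * v.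
Proof.
apply: tensP => V f bf; rewrite [LHS]tliftZ // !tliftMl // scaler_sumr.
by apply: eq_bigr => r _; rewrite tliftZ //; exact: bil_mull.
Qed.
Lemma tscaleAr (c : K) (u v : tens) : c *: (u * v) = u * (c *: v).
Proof.
apply: tensP => V f bf; rewrite [LHS]tliftZ // !tliftMr // scaler_sumr.
by apply: eq_bigr => r _; rewrite tliftZ //; exact: bil_mulr.
Qed.

Definition tscalar (c : K) : tens := c *: (1 : tens).
Fact tscalar_nmod : nmod_morphism tscalar.
Proof. by split=> [|a b]; rewrite /tscalar ?scale0r ?scalerDl. Qed.
Fact tscalar_monoid : monoid_morphism tscalar.
Proof. by split=> [|a b]; rewrite /tscalar ?scale1r // -tscaleAl mul1r scalerA. Qed.
HB.instance Definition _ := GRing.isNmodMorphism.Build K tens tscalar tscalar_nmod.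
HB.instance Definition _ := GRing.isMonoidMorphism.Build K tens tscalar tscalar_monoid.

Lemma tpureD1 a a' b : tpure (a + a') b = tpure a b + tpure a' b.
Proof.
by apply: tensP => V f bf; rewrite [RHS]tliftD // !tlift_pure // (bilD1 bf).
Qed.
Lemma tpureD2 a b b' : tpure a (b + b') = tpure a b + tpure a b'.
Proof.
by apply: tensP => V f bf; rewrite [RHS]tliftD // !tlift_pure // (bilD2 bf).
Qed.
Lemma tpureZ1 c a b : tpure (c *: a) b = c *: tpure a b.
Proof.
by apply: tensP => V f bf; rewrite [RHS]tliftZ // !tlift_pure // (bilZ1 bf).
Qed.
Lemma tpureZ2 c a b : tpure a (c *: b) = c *: tpure a b.
Proof.
by apply: tensP => V f bf; rewrite [RHS]tliftZ // !tlift_pure // (bilZ2 bf).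
Qed.

End TensorProduct.

Section Hopf.
Variables (K : fieldType) (q : K).
Local Notation W := (walg q).
Local Notation X := (wX q).
Local Notation X' := (wXV q).
Local Notation Y := (wY q).

Lemma wYXV : Y * X' = q ^+ 2 *: (X' * Y).
Proof.
transitivity (X' * (X * Y) * X'); first by rewrite mulrA wXV_X mul1r.
by rewrite wXY -scalerAr -scalerAl !mulrA -(mulrA _ X X') wX_XV mulr1.
Qed.

Definition counit : W -> K := @wlift _ q K idfun 1 1 0.

Fact counit_nmod : nmod_morphism counit.
Proof.
split; [exact: (wlift0 (walg_counit_rels q)) |
        exact: (wliftD (walg_counit_rels q))].
Qed.
Fact counit_monoid : monoid_morphism counit.
Proof.
split; [exact: (wlift1 (walg_counit_rels q)) |
        exact: (wliftM (walg_counit_rels q))].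
Qed.
HB.instance Definition _ := GRing.isNmodMorphism.Build W K counit counit_nmod.
HB.instance Definition _ := GRing.isMonoidMorphism.Build W K counit counit_monoid.
Fact counit_scal : scalable_for *%R counit.
Proof. by move=> c u; rewrite wscaleE rmorphM /= [counit (wC _ _)](wliftC (walg_counit_rels q)). Qed.
HB.instance Definition _ := GRing.isScalable.Build K W K *%R counit counit_scal.

Lemma counitX : counit X = 1. Proof. exact: (wliftX (walg_counit_rels q)). Qed.
Lemma counitY : counit Y = 0. Proof. exact: (wliftY (walg_counit_rels q)). Qed.

Local Notation WW := (tens W W).
Definition coprod : W -> WW :=
  wlift (@tscalar _ W W) (tpure X X) (tpure X' X') (tpure Y X + tpure 1 Y).

Fact coprod_rels :
  wrels q (@tscalar _ W W) (tpure X X) (tpure X' X') (tpure Y X + tpure 1 Y).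
Proof.
split=> [c a|||]; rewrite /tscalar.
- by rewrite -tscaleAl mul1r -tscaleAr mulr1.
- by rewrite tpureM wX_XV.
- by rewrite tpureM wXV_X.
rewrite -tscaleAl mul1r mulrDl mulrDr !tpureM mul1r mulr1 wXY.
by rewrite tpureZ1 tpureZ2 scalerDr.
Qed.

Fact coprod_nmod : nmod_morphism coprod.
Proof. by split; [exact: (wlift0 coprod_rels) | exact: (wliftD coprod_rels)]. Qed.
Fact coprod_monoid : monoid_morphism coprod.
Proof. by split; [exact: (wlift1 coprod_rels) | exact: (wliftM coprod_rels)]. Qed.
HB.instance Definition _ := GRing.isNmodMorphism.Build W WW coprod coprod_nmod.
HB.instance Definition _ := GRing.isMonoidMorphism.Build W WW coprod coprod_monoid.
Fact coprod_scal : scalable coprod.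
Proof.
move=> c u; rewrite wscaleE rmorphM /= [coprod (wC _ _)](wliftC coprod_rels).
by rewrite /tscalar -tscaleAl mul1r.
Qed.
HB.instance Definition _ := GRing.isScalable.Build K W WW *:%R coprod coprod_scal.

Lemma coprodX : coprod X = tpure X X. Proof. exact: (wliftX coprod_rels). Qed.
Lemma coprodY : coprod Y = tpure Y X + tpure 1 Y.
Proof. exact: (wliftY coprod_rels). Qed.

(* The antipode, an algebra morphism to the opposite algebra W^c. *)
Definition cscalar (c : K) : W^c := wC q c.
Fact cscalar_nmod : nmod_morphism cscalar.
Proof. by split=> // a b; exact: wC_add. Qed.
Fact cscalar_monoid : monoid_morphism cscalar.
Proof. by split=> // a b; rewrite /cscalar mulrC; exact: wC_mul. Qed.
HB.instance Definition _ := GRing.isNmodMorphism.Build K W^c cscalar cscalar_nmod.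
HB.instance Definition _ :=
  GRing.isMonoidMorphism.Build K W^c cscalar cscalar_monoid.

Definition antipode : W -> W^c := wlift cscalar X' X (- (Y * X') : W).

Fact antipode_rels : wrels q cscalar X' X (- (Y * X') : W).
Proof.
split=> [c a|||].
- exact: (esym (wmulCC c a)).
- exact: wX_XV.
- exact: wXV_X.
transitivity (- (Y * X') * X' : W) => //.
transitivity (X' * - (Y * X') * wC q (q ^+ 2) : W) => //.
rewrite -[RHS]wmulCC -[wmul _ _]wscaleE mulrN mulrA scalerN.
by rewrite scalerAl -wYXV mulNr.
Qed.

Fact antipode_nmod : nmod_morphism antipode.
Proof. by split; [exact: (wlift0 antipode_rels) | exact: (wliftD antipode_rels)]. Qed.
Fact antipode_monoid : monoid_morphism antipode.
Proof. by split; [exact: (wlift1 antipode_rels) | exact: (wliftM antipode_rels)]. Qed.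
HB.instance Definition _ :=
  GRing.isNmodMorphism.Build W W^c antipode antipode_nmod.
HB.instance Definition _ :=
  GRing.isMonoidMorphism.Build W W^c antipode antipode_monoid.

Lemma antipodeX : antipode X = X'. Proof. exact: (wliftX antipode_rels). Qed.
Lemma antipodeY : antipode Y = - (Y * X') :> W.
Proof. exact: (wliftY antipode_rels). Qed.

End Hopf.

(* An n-dimensional left module K^n (column vectors) is an algebra morphism    *)
(* to the n x n matrices; w.v is rho w *m v.                                   *)
Notation rep q n := {lrmorphism walg q -> 'M_n}.

Section Representations.
Variables (K : fieldType) (q : K).
Local Notation W := (walg q).

Section Generators.
Variables (n : nat) (x xv y : 'M[K]_n) (h : wrels q (@scalar_mx K n) x xv y).

(* The proof argument only serves to make [genrep h] an algebra morphism. *)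
Definition genrep & wrels q (@scalar_mx K n) x xv y : W -> 'M[K]_n :=
  wlift (@scalar_mx K n) x xv y.

Fact genrep_nmod : nmod_morphism (genrep h).
Proof. by split; [exact: (wlift0 h) | exact: (wliftD h)]. Qed.
Fact genrep_monoid : monoid_morphism (genrep h).
Proof. by split; [exact: (wlift1 h) | exact: (wliftM h)]. Qed.
HB.instance Definition _ :=
  GRing.isNmodMorphism.Build W 'M[K]_n (genrep h) genrep_nmod.
HB.instance Definition _ :=
  GRing.isMonoidMorphism.Build W 'M[K]_n (genrep h) genrep_monoid.
Fact genrep_scal : scalable (genrep h).
Proof.
move=> c u; rewrite wscaleE rmorphM /= [genrep h (wC _ _)](wliftC h).
exact: mul_scalar_mx.
Qed.
HB.instance Definition _ :=
  GRing.isScalable.Build K W 'M[K]_n *:%R (genrep h) genrep_scal.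

Lemma genrepX : genrep h (wX q) = x. Proof. exact: (wliftX h). Qed.
Lemma genrepY : genrep h (wY q) = y. Proof. exact: (wliftY h). Qed.
End Generators.

Definition trivrep (n : nat) (w : W) : 'M[K]_n := (counit w)%:M.

Section Trivial.
Variable n : nat.
Fact trivrep_nmod : nmod_morphism (trivrep n).
Proof. by split=> [|a b]; rewrite /trivrep ?raddf0 ?raddfD. Qed.
Fact trivrep_monoid : monoid_morphism (trivrep n).
Proof. by split=> [|a b]; rewrite /trivrep ?rmorph1 ?rmorphM. Qed.
Fact trivrep_scal : scalable (trivrep n).
Proof. by move=> c u; rewrite /trivrep linearZ /= scale_scalar_mx. Qed.
HB.instance Definition _ :=
  GRing.isNmodMorphism.Build W 'M[K]_n (trivrep n) trivrep_nmod.
HB.instance Definition _ :=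
  GRing.isMonoidMorphism.Build W 'M[K]_n (trivrep n) trivrep_monoid.
HB.instance Definition _ :=
  GRing.isScalable.Build K W 'M[K]_n *:%R (trivrep n) trivrep_scal.
End Trivial.

Section Tensor.
Variables (n m : nat) (rho : rep q n) (sigma : rep q m).

Definition tensrep (w : W) : 'M[K]_(n * m) :=
  tlift (fun a b => rho a *t sigma b) (coprod w).

Lemma tensrep_bil : bilinear_for *:%R *:%R (fun a b => rho a *t sigma b).
Proof.
split=> [b|a] c x y /=; apply/matrixP=> i j; rewrite linearP !mxE.
- by rewrite mulrDl mulrA.
- by rewrite mulrDr mulrCA.
Qed.

Lemma tlift_rep_mul u v :
  tlift (fun a b => rho a *t sigma b) (u * v) =
  tlift (fun a b => rho a *t sigma b) u *m tlift (fun a b => rho a *t sigma b) v.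
Proof.
rewrite [LHS](tliftMr _ _ tensrep_bil) [X in X *m _]/tlift /tsum mulmx_suml.
apply: eq_bigr => p _; rewrite /tlift /tsum mulmx_sumr.
by apply: eq_bigr => r _; rewrite tensmx_mul !rmorphM.
Qed.

Fact tensrep_nmod : nmod_morphism tensrep.
Proof.
split=> [|a b]; rewrite /tensrep.
- by rewrite raddf0 [LHS](tlift_repr0 tensrep_bil).
- by rewrite raddfD [LHS](tliftD tensrep_bil).
Qed.
Fact tensrep_monoid : monoid_morphism tensrep.
Proof.
split=> [|a b]; rewrite /tensrep ?rmorphM ?tlift_rep_mul // rmorph1.
rewrite [LHS](tlift_pure tensrep_bil) !rmorph1; apply/matrixP=> i j.
case: (mxtens_indexP i) => a b; case: (mxtens_indexP j) => c d.
rewrite tensmxE !mxE -natrM mulnb; congr (_%:R).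
by rewrite (can_eq (@mxtens_indexK _ _)).
Qed.
Fact tensrep_scal : scalable tensrep.
Proof.
by move=> c u; rewrite /tensrep linearZ /= [LHS](tliftZ tensrep_bil).
Qed.
HB.instance Definition _ :=
  GRing.isNmodMorphism.Build W 'M[K]_(n * m) tensrep tensrep_nmod.
HB.instance Definition _ :=
  GRing.isMonoidMorphism.Build W 'M[K]_(n * m) tensrep tensrep_monoid.
HB.instance Definition _ :=
  GRing.isScalable.Build K W 'M[K]_(n * m) *:%R tensrep tensrep_scal.

Lemma tensrepX : tensrep (wX q) = rho (wX q) *t sigma (wX q).
Proof. by rewrite /tensrep coprodX (tlift_pure tensrep_bil). Qed.
Lemma tensrepY :
  tensrep (wY q) = rho (wY q) *t sigma (wX q) + 1%:M *t sigma (wY q).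
Proof.
rewrite /tensrep coprodY [LHS](tliftD tensrep_bil) !(tlift_pure tensrep_bil).
by rewrite rmorph1.
Qed.

End Tensor.

Definition intertwines (n m : nat) (rho : rep q n) (sigma : rep q m)
    (F : 'M[K]_(m, n)) : Prop :=
  forall w : W, F *m rho w = sigma w *m F.

End Representations.

Local Open Scope complex_scope.

Section Setting.
Variables (R : realType) (N : nat).
Local Notation C := R[i].

(* q = exp (pi sqrt(-1) / N) *)
Definition qN : C := cos (pi / N%:R) +i* sin (pi / N%:R).

(* e_k is the column vector delta_mx k 0, and ordS is the successor mod N. *)
Definition Amx : 'M[C]_N := diag_mx (\row_(k < N) qN ^+ (2 * k)).
Definition Bmx : 'M[C]_N := \matrix_(i, j) (i == ordS j)%:R.

(* The fixed choice z |-> z^(1/N); the value at 0 is unconstrained and unused. *)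
Record nth_root := NthRoot {
  nroot :> C -> C;
  nrootX : forall z, z != 0 -> nroot z ^+ N = z;
  nroot1 : nroot 1 = 1;
  nrootV : forall z, z != 0 -> (nroot z)^-1 = nroot z^-1;
  nrootN : forall z, z != 0 -> nroot (- z) = - nroot z }.

Definition weight : Type := (C * C)%type.
Definition nonsingular (l : weight) : bool := (l.1 != 0) && (l.2 != 0).
Definition weight_mul (l l' : weight) : weight :=
  (l.1 * l'.1, l.2 * l'.1 + l'.2).

Lemma qN_exp k : qN ^+ k = cos (k%:R * (pi / N%:R)) +i* sin (k%:R * (pi / N%:R)).
Proof.
rewrite /qN; move: (pi / N%:R) => t.
elim: k => [|k IH]; first by rewrite mul0r cos0 sin0.
rewrite exprS IH -natr1 mulrDl mul1r cosD sinD; simpc.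
by apply/eqP; rewrite eq_complex /=; apply/andP; split; apply/eqP => //; ring.
Qed.

Lemma qN_neq0 : qN != 0.
Proof.
apply/eqP => /eqP; rewrite eq_complex /= => /andP[/eqP c0 /eqP s0].
have := cos2Dsin2 (pi / N%:R : R); rewrite c0 s0 expr0n /= addr0.
by move=> /esym/eqP; rewrite oner_eq0.
Qed.

Lemma qN_expN : (0 < N)%N -> qN ^+ N = -1.
Proof.
move=> N0; rewrite qN_exp mulrC divfK ?pnatr_eq0 -?lt0n // cospi sinpi.
by apply/eqP; rewrite eq_complex /= oppr0 !eqxx.
Qed.

Lemma qN_exp2N : (0 < N)%N -> qN ^+ (2 * N) = 1.
Proof. by move=> N0; rewrite mulnC exprM qN_expN // sqrrN expr1n. Qed.

Lemma qN_mod k : (0 < N)%N -> qN ^+ (2 * (k %% N)) = qN ^+ (2 * k).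
Proof.
move=> N0; rewrite {2}(divn_eq k N) mulnDr exprD.
have -> : (2 * (k %/ N * N) = 2 * N * (k %/ N))%N by rewrite mulnCA mulnC.
by rewrite [qN ^+ (2 * N * _)]exprM qN_exp2N // expr1n mul1r.
Qed.

Lemma AmxBmx : Amx *m Bmx = qN ^+ 2 *: (Bmx *m Amx).
Proof.
rewrite mul_diag_mx mul_mx_diag; apply/matrixP => i j; rewrite !mxE.
case: eqP => [->|_]; rewrite ?mulr0 ?mul0r ?mulr0 // mulr1 mul1r -exprD.
by rewrite qN_mod ?(leq_ltn_trans _ (ltn_ord j)) // mulnS.
Qed.

Lemma Amx_unit : Amx \in unitmx.
Proof.
rewrite unitmxE det_diag unitfE; apply/prodf_neq0 => i _.
by rewrite mxE expf_neq0 ?qN_neq0.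
Qed.

Hypothesis oddN : odd N.
Variable rt : nth_root.

Lemma nroot_neq0 z : z != 0 -> rt z != 0.
Proof.
move=> z0; apply/eqP => r0; have := nrootX rt z0.
by rewrite r0 expr0n; case: N oddN => // n _ /= /esym/eqP; exact/negP.
Qed.

Fact Vrep_rels (l : weight) : nonsingular l ->
  wrels qN (@scalar_mx C N) (rt l.1 *: Amx) (invmx (rt l.1 *: Amx))
    (rt l.2 *: Bmx).
Proof.
case/andP => l1 l2.
have u : rt l.1 *: Amx \in unitmx.
  by rewrite unitmxZ ?Amx_unit // unitfE nroot_neq0.
split=> [c a|||]; [by rewrite -mulmxE scalar_mxC | exact: mulmxV | exact: mulVmx |].
rewrite -[RHS]/(_ *m (_ *m _)) mul_scalar_mx -!mulmxE -!scalemxAl -!scalemxAr.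
by rewrite AmxBmx !scalerA; congr (_ *: _); ring.
Qed.

Definition Vrep (l : weight) (hl : nonsingular l) : rep qN N :=
  genrep (Vrep_rels hl).

Lemma VrepX l (hl : nonsingular l) : Vrep hl (wX qN) = rt l.1 *: Amx.
Proof. exact: genrepX. Qed.
Lemma VrepY l (hl : nonsingular l) : Vrep hl (wY qN) = rt l.2 *: Bmx.
Proof. exact: genrepY. Qed.

(* X and Y act invertibly on V_l (x) V_l'. *)
Definition regular (l l' : weight) (hl : nonsingular l) (hl' : nonsingular l')
    : bool :=
  (tensrep (Vrep hl) (Vrep hl') (wX qN) \in unitmx) &&
  (tensrep (Vrep hl) (Vrep hl') (wY qN) \in unitmx).

Let N_gt0 : (0 < N)%N. Proof. exact: odd_gt0. Qed.

Definition ebasis (k : nat) : 'cV[C]_N :=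
  delta_mx (Ordinal (ltn_pmod k N_gt0)) 0.

Lemma Amx_ebasis k : Amx *m ebasis k = qN ^+ (2 * k) *: ebasis k.
Proof.
rewrite mul_diag_mx; apply/matrixP=> i j; rewrite !mxE.
by case: eqP => [->|]; rewrite ?mulr0 //= qN_mod.
Qed.

Lemma Bmx_ebasis k : Bmx *m ebasis k = ebasis k.+1.
Proof.
rewrite -colE; apply/matrixP=> i j; rewrite !mxE ord1 eqxx andbT.
by congr (_%:R); congr (_ == _); apply/val_inj; rewrite /= -addn1 modnDml addn1.
Qed.

Lemma ebasis_period k : ebasis (k + N) = ebasis k.
Proof.
by congr delta_mx; apply: val_inj; rewrite /= modnDr.
Qed.

Lemma regular_nonsingular (l l' : weight)
    (hl : nonsingular l) (hl' : nonsingular l') :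
  regular hl hl' -> nonsingular (weight_mul l l').
Proof.
case/andP => _ Yu; have /andP[l1 l2] := hl; have /andP[l'1 l'2] := hl'.
rewrite /nonsingular /= mulf_neq0 //=; apply/eqP => s0.
pose al := rt l.2 * rt l'.1; pose be := rt l'.2; pose r := - (al / be).
have be0 : be != 0 by exact: nroot_neq0.
have rN : r ^+ N = 1.
  rewrite exprNn -signr_odd oddN expr1 mulN1r expr_div_n exprMn !nrootX //.
  by move/eqP: s0; rewrite addr_eq0 => /eqP ->; rewrite mulNr opprK divff.
pose c k := r ^+ k * \prod_(i < k) qN ^+ (2 * (N - i)).
have cN : c N = 1.
  rewrite /c rN mul1r -expr_sum -big_distrr /=.
  rewrite (reindex_inj rev_ord_inj) /=.
  rewrite (eq_bigr (fun i : 'I_N => i + 1)%N) => [|i _]; last first.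
    by rewrite subKn // addn1.
  rewrite big_split /= sum1_card card_ord -(big_mkord xpredT id) bin2_sum.
  by rewrite bin2odd // -mulnSr mulnA exprM qN_exp2N // expr1n.
have cS k : al * qN ^+ (2 * (N - k)) * c k = - (be * c k.+1).
  rewrite /c exprS big_ord_recr /= !mulrA.
  by rewrite (_ : be * r = - al) ?mulrN 1?mulrC ?divfK //; ring.
pose v := \sum_(i < N) c i *: (ebasis i *t ebasis (N - i)).
pose t k := (be * c k) *: (ebasis k *t ebasis (N - k).+1).
have Yv : tensrep (Vrep hl) (Vrep hl') (wY qN) *m v = 0.
  rewrite tensrepY !VrepX !VrepY mulmxDl !mulmx_sumr.
  transitivity (- (\sum_(i < N) t i.+1) + \sum_(i < N) t i).
    rewrite -sumrN; congr (_ + _); apply: eq_bigr => i _.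
      rewrite -scalemxAr tensmx_mul -!scalemxAl Bmx_ebasis Amx_ebasis.
      rewrite /t subnSK // -scaleNr -cS /al.
      by apply/matrixP => a b; rewrite !mxE; ring.
    rewrite -scalemxAr tensmx_mul -!scalemxAl Bmx_ebasis mul1mx /t /be.
    by apply/matrixP => a b; rewrite !mxE; ring.
  apply/eqP; rewrite addrC subr_eq0; apply/eqP.
  rewrite -(big_mkord xpredT t) -(big_mkord xpredT (fun i => t i.+1)).
  apply: (addIr (t N)).
  rewrite -big_nat_recr //= big_nat_recl // addrC; congr (_ + _).
  rewrite /t cN subn0 subnn /c expr0 big_ord0 mulr1.
  by rewrite (ebasis_period 0 : ebasis N = _) (ebasis_period 1 : ebasis N.+1 = _).
have v0 : v = 0 by rewrite -[v](mulKmx Yu) Yv mulmx0.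
have := congr1 (fun M : 'M_(N * N, 1 * 1) =>
  M (mxtens_index (Ordinal N_gt0, Ordinal N_gt0)) (mxtens_index (ord0 : 'I_1, ord0 : 'I_1))) v0.
rewrite summxE (bigD1 (Ordinal N_gt0)) //= big1 => [|i i0]; last first.
  rewrite !mxE !mxtens_indexK /= -!val_eqE /= modn_small //.
  by move: i0; rewrite -val_eqE /= eq_sym => /negbTE ->; rewrite mul0r mulr0.
rewrite !mxE !mxtens_indexK /= -!val_eqE /= subn0 modnn mod0n eqxx.
rewrite /c expr0 big_ord0 !mulr1 addr0 => /eqP; exact/negP/oner_neq0.
Qed.

(* m_{z,w}; it is only used for z, w != 0, where it exists and is unique. *)
Definition root_defect (z w : C) : nat :=
  if [pick m : 'I_N | rt (z * w) == qN ^+ (2 * m) * rt z * rt w] is Some m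
  then m else 0%N.

(* w(a, c | n) *)
Definition cqdilog (a c : C) (n : nat) : C :=
  \prod_(1 <= j < n.+1) (c - a * qN ^+ (2 * j))^-1.

(* Phi^q_{a,c}(M), specified by its action on the eigenspaces of M; when       *)
(* M ^+ N = 1 these span the whole space and the specification determines it.  *)
Definition qdilog_spec (zeta : C -> C -> C) (a c : C) n (M : 'M[C]_n) :
    set 'M[C]_n :=
  [set P | forall (i : 'I_N) (v : 'cV_n),
    M *m v = qN ^+ (2 * i) *: v -> P *m v = (zeta a c * cqdilog a c i) *: v].
Definition qdilog zeta a c n (M : 'M[C]_n) : 'M[C]_n :=
  xget 0 (qdilog_spec zeta a c M).

Definition B1mx : 'M[C]_(N * N) := Bmx *t 1%:M.
Definition A2mx : 'M[C]_(N * N) := 1%:M *t Amx.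
Definition B2mx : 'M[C]_(N * N) := 1%:M *t Bmx.

(* S (e_i (x) e_j) = e_i (x) e_(i + j), indices mod N. *)
Definition Smx : 'M[C]_(N * N) :=
  \sum_(i < N) \sum_(j < N) delta_mx i i *t delta_mx (iter i (@ordS N) j) j.

Definition Fmx (zeta : C -> C -> C) (l l' : weight) : 'M[C]_(N * N) :=
  let: (x, y) := l in let: (x', y') := l' in
  let s := rt (y * x' + y') in
  let a := - (rt y * rt x' / s) in
  let c := rt y' / s in
  invmx B2mx ^+ root_defect x x' *m
    (Smx *m qdilog zeta a c (B1mx *m A2mx *m invmx B2mx)).

End Setting.

(* Main.v *)
(* Write [C = B_1 A_2 B_2^-1]. As [C ^ N = 1], the space is spanned by the       *)
(* eigenspaces of [C], so identities involving [Phi (C)] can be tested on them.  *)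
(* [X] acts on [V_l (x) V_l'] as a multiple of [A_1 A_2], which commutes with    *)
(* [C] and is sent to [A_2] by [S]; the factor [B_2 ^ (- m)] corrects the N-th   *)
(* root. [Y] acts as [s (c - a C) B_2] with [s = (y x' + y') ^ (1 / N)], and     *)
(* since [B_2] maps the [q ^ (2 i)]-eigenspace of [C] to the next one, the       *)
(* recursion [(c - a q ^ (2 (i + 1))) w (i + 1) = w (i)] amounts to              *)
(* [Phi (C) (c - a C) B_2 = B_2 Phi (C)].                                        *)
Require Import Defs.
From HB Require Import structures.
From mathcomp Require Import all_boot all_order all_algebra.
From mathcomp Require Import boolp classical_sets reals trigo.
From mathcomp Require Import complex mxtens.

Set Implicit Arguments.
Unset Strict Implicit.
Unset Printing Implicit Defensive.

Import Order.TTheory GRing.Theory Num.Theory.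
Local Open Scope ring_scope.

(** By [tensrep_triv] the target acts as id (x) W, and [intertwines_gen] reduces intertwining to [X]
    and [Y]. The [X] identity comes from [qdilog_comm] and [Smx_AA], the [Y] identity from
    [qdilog_shift] and [Smx_B2]. The two facts about Phi are tested on the eigenspaces of C, which
    span by [CmxN] and [eigen_ext].

    The recursion for w closes up modulo N because the product of the c - a q^(2j) over a period is
    c^N - a^N ([prod_unity_root]). As N is odd, this is (y' + y x') / (y x' + y') = 1. The same
    equation keeps each factor nonzero, so Phi is invertible, and F is a product of invertible
    maps. *)

Section MatrixComplements.

(** * Tensor products and powers of q-commuting matrices *)

Variable K : fieldType.

Lemma tensmx11 m n : (1%:M : 'M[K]_m) *t (1%:M : 'M[K]_n) = 1%:M.
Proof.
apply/matrixP => i j; case: (mxtens_indexP i) => a b.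
case: (mxtens_indexP j) => c d; rewrite tensmxE !mxE -natrM mulnb.
by rewrite (can_eq (@mxtens_indexK _ _)).
Qed.

Lemma tensmxZZ m n p r (a b : K) (A : 'M_(m, n)) (B : 'M_(p, r)) :
  (a *: A) *t (b *: B) = (a * b) *: (A *t B).
Proof. by apply/matrixP => i j; rewrite !mxE mulrACA. Qed.

Lemma tensmx_suml (I : finType) m n p r (A : I -> 'M[K]_(m, n))
    (B : 'M[K]_(p, r)) : (\sum_i A i) *t B = \sum_i (A i *t B).
Proof.
apply/matrixP => i j; rewrite mxE !summxE big_distrl.
by apply: eq_bigr => k _; rewrite mxE.
Qed.

Lemma tensmx_sumr (I : finType) m n p r (A : 'M[K]_(m, n))
    (B : I -> 'M[K]_(p, r)) : A *t (\sum_i B i) = \sum_i (A *t B i).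
Proof.
apply/matrixP => i j; rewrite mxE !summxE big_distrr.
by apply: eq_bigr => k _; rewrite mxE.
Qed.

Lemma tensmxX m n (A : 'M[K]_m) (B : 'M[K]_n) k :
  (A *t B) ^+ k = A ^+ k *t B ^+ k.
Proof.
elim: k => [|k IH]; first by rewrite !expr0; apply: esym (tensmx11 _ _).
by rewrite !exprS IH -!mulmxE tensmx_mul.
Qed.

Lemma mulmx_qcommX n (A V : 'M[K]_n) r k :
  V *m A = r *: (A *m V) -> V ^+ k *m A = r ^+ k *: (A *m V ^+ k).
Proof.
move=> VA; elim: k => [|k IH]; first by rewrite !expr0 scale1r mul1mx mulmx1.
rewrite exprSr -mulmxE -mulmxA VA -scalemxAr (mulmxA (V ^+ k)) IH -scalemxAl.
by rewrite scalerA -exprS mulmxA.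
Qed.

(** Collecting the [A]s on the left costs 0 + 1 + ... + (k - 1) factors [r]. *)
Lemma exprM_qcomm n (A V : 'M[K]_n) r k :
  V *m A = r *: (A *m V) ->
  (A *m V) ^+ k = r ^+ 'C(k, 2) *: (A ^+ k *m V ^+ k).
Proof.
move=> VA; elim: k => [|k IH]; first by rewrite !expr0 scale1r mulmx1.
rewrite exprSr IH -mulmxE -scalemxAl -[A ^+ k *m _ *m _]mulmxA.
rewrite (mulmxA (V ^+ k)) (mulmx_qcommX _ VA) -scalemxAl -scalemxAr scalerA.
rewrite -exprD binS bin1; congr (_ *: _).
by rewrite [A ^+ k.+1]exprSr [V ^+ k.+1]exprSr -!mulmxE !mulmxA.
Qed.

End MatrixComplements.

(** * Roots of unity and spectral decomposition of operators of finite order *)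

Section RootsOfUnity.
Variables (K : numFieldType) (N : nat) (z : K).
Hypothesis zP : N.-primitive_root z.
Let N_gt0 : (0 < N)%N := prim_order_gt0 zP.

Let zX_neq0 i : z ^+ i != 0.
Proof. by rewrite expf_neq0 // (prim_root_eq0 zP) -lt0n. Qed.

Lemma sum_unity_root (u : K) : u ^+ N = 1 ->
  \sum_(k < N) u ^+ k = N%:R *+ (u == 1).
Proof.
move=> uN; case: eqP => [->|/eqP u1].
  by under eq_bigr do rewrite expr1n; rewrite sumr_const card_ord.
apply/eqP; rewrite mulr0n -(mulrI_eq0 _ (@mulfI _ (u - 1) _)) ?subr_eq0 //.
by rewrite -subrX1 uN subrr.
Qed.

(** Evaluate the factorization of X^N - 1 at c / a and multiply by a^N; a = 0 is separate. *)
Lemma prod_unity_root (a c : K) :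
  \prod_(1 <= j < N.+1) (c - a * z ^+ j) = c ^+ N - a ^+ N.
Proof.
have shift : \prod_(1 <= j < N.+1) (c - a * z ^+ j) =
             \prod_(0 <= j < N) (c - a * z ^+ j).
  case: N N_gt0 (prim_expr_order zP) => // n _ zn.
  by rewrite big_nat_recr //= zn [RHS]big_nat_recl //= mulrC big_add1.
rewrite shift; have [->|a0] := eqVneq a 0.
  under eq_bigr do rewrite mul0r subr0.
  by rewrite prodr_const_nat subn0 expr0n eqn0Ngt N_gt0 subr0.
have := congr1 (fun p => p.[c / a]) (factor_Xn_sub_1 zP).
rewrite !hornerE horner_prod => /(congr1 ( *%R (a ^+ N))).
rewrite mulrBr mulr1 expr_div_n [a ^+ N * (_ / _)]mulrC.
rewrite divfK ?expf_neq0 // => <-.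
rewrite mulrC -{3}[N]subn0 -prodr_const_nat -big_split /=.
by apply: eq_bigr => j _; rewrite !hornerE mulrBl divfK // [z ^+ j * a]mulrC.
Qed.

Section Projector.
Variables (n : nat) (M : 'M[K]_n).
Hypothesis MN : M ^+ N = 1.

(** Spectral projector onto the z^i-eigenspace: a Fourier coefficient of k -> M^k on Z/N. *)
Definition eigenproj (i : nat) : 'M[K]_n :=
  N%:R^-1 *: \sum_(k < N) (z ^- i) ^+ k *: M ^+ k.

(** Multiplying by [M] shifts the summation index by one, and the summand is N-periodic. *)
Lemma eigenprojP i : M *m eigenproj i = z ^+ i *: eigenproj i.
Proof.
pose f k := (z ^- i) ^+ k *: M ^+ k.
rewrite -scalemxAr scalerA mulrC -scalerA; congr (_ *: _).
rewrite mulmx_sumr scaler_sumr.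
transitivity (\sum_(k < N) z ^+ i *: f k.+1).
  apply: eq_bigr => k _; rewrite /f -scalemxAr mulmxE -exprS scalerA.
  by rewrite [(z ^- i) ^+ k.+1]exprS mulrA divff ?mul1r.
rewrite -!scaler_sumr; congr (_ *: _).
have fN : f N = f 0%N.
  by rewrite /f MN expr0 expr0 exprVn -exprM mulnC exprM (prim_expr_order zP)
    expr1n invr1.
rewrite -(big_mkord xpredT f) -(big_mkord xpredT (fun k => f k.+1)).
by apply: (addrI (f 0%N)); rewrite -big_nat_recl // big_nat_recr //= fN addrC.
Qed.

Lemma sum_eigenproj : \sum_(i < N) eigenproj i = 1%:M.
Proof.
rewrite -scaler_sumr exchange_big /=.
rewrite (eq_bigr (fun k : 'I_N => (N%:R *+ (k == 0%N :> nat)) *: M ^+ k)).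
  rewrite (bigD1 (Ordinal N_gt0)) //= big1 => [|k k0]; last first.
    by rewrite -val_eqE /= in k0; rewrite (negbTE k0) scale0r.
  by rewrite addr0 expr0 scalerA mulVf ?scale1r // pnatr_eq0 -lt0n.
move=> k _; rewrite -scaler_suml; congr (_ *: _).
have -> : (k == 0%N :> nat) = (z ^- k == 1).
  by rewrite invr_eq1 -(prim_order_dvd zP) /dvdn modn_small.
rewrite -sum_unity_root.
  by apply: eq_bigr => i _; rewrite !exprVn -!exprM mulnC.
by rewrite exprVn -exprM mulnC exprM (prim_expr_order zP) expr1n invr1.
Qed.

Lemma eigenproj_eigen (i j : 'I_N) p (V : 'M_(n, p)) :
  M *m V = z ^+ j *: V -> eigenproj i *m V = (i == j)%:R *: V.
Proof.
move=> MV; have MkV k : M ^+ k *m V = (z ^+ j) ^+ k *: V.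
  elim: k => [|k IH]; first by rewrite !expr0 mul1mx scale1r.
  by rewrite exprSr -mulmxE -mulmxA MV -scalemxAr IH scalerA -exprS.
rewrite -scalemxAl mulmx_suml.
under eq_bigr do rewrite -scalemxAl MkV scalerA -exprMn.
rewrite -scaler_suml sum_unity_root; last first.
  rewrite exprMn exprVn -!exprM ![(_ * N)%N]mulnC !exprM (prim_expr_order zP).
  by rewrite !expr1n invr1 mulr1.
rewrite scalerA; congr (_ *: _); rewrite mulrC.
have -> : (z ^- i * z ^+ j == 1) = (i == j).
  rewrite -(inj_eq (mulfI (zX_neq0 i))) mulVKf ?mulr1 //.
  by rewrite (eq_prim_root_expr zP) eq_sym /eqn !modn_small.
case: eqP => _; rewrite ?mulr1n ?mulr0n ?mul0r //.
by rewrite divff // pnatr_eq0 -lt0n.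
Qed.

(** The test [W] is a square matrix so that it can be a projector; the projectors sum to the
    identity. *)
Lemma eigen_ext p (U V : 'M_(p, n)) :
  (forall (i : 'I_N) (W : 'M_n), M *m W = z ^+ i *: W -> U *m W = V *m W) ->
  U = V.
Proof.
move=> UV; rewrite -[U]mulmx1 -[V]mulmx1 -sum_eigenproj !mulmx_sumr.
by apply: eq_bigr => i _; apply: UV (eigenprojP i).
Qed.

End Projector.
End RootsOfUnity.

(** * Reduction of statements about W to its generators *)

Section Generation.
Variables (K : fieldType) (q : K).
Local Notation W := (walg q).

Lemma walg_ind (P : W -> Prop) :
  P (wX q) -> P (wXV q) -> P (wY q) -> (forall c : K, P (c *: 1)) ->
  (forall u v, P u -> P v -> P (u + v)) ->
  (forall u v, P u -> P v -> P (u * v)) -> forall w, P w.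
Proof.
move=> PX PXV PY PC PD PM; elim/quotW; elim=> //.
- by move=> c; have := PC c; rewrite wscaleE mulr1.
- by move=> s Ps t Pt; rewrite wpiD; apply: PD.
- by move=> s Ps t Pt; rewrite wpiM; apply: PM.
Qed.

Lemma intertwines_gen n m (rho : rep q n) (sigma : rep q m) (F : 'M_(m, n)) :
  F *m rho (wX q) = sigma (wX q) *m F -> F *m rho (wY q) = sigma (wY q) *m F ->
  intertwines rho sigma F.
Proof.
move=> FX FY; apply: walg_ind => // [|c|u v Fu Fv|u v Fu Fv].
(* Insert sigma(X^-1) sigma(X) on the left, then move sigma(X) across F to cancel rho(X^-1). *)
- rewrite -[LHS]mul1mx -[1%:M]/(1 : 'M_m) -(rmorph1 sigma) -(wXV_X q) rmorphM.
  rewrite -mulmxE -mulmxA (mulmxA (sigma (wX q))) -FX -(mulmxA F) mulmxE.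
  by rewrite -rmorphM wX_XV rmorph1 -[1]/(1%:M) mulmx1.
- by rewrite !linearZ /= !rmorph1 -scalemxAl mulmx1 mul1mx.
- by rewrite !rmorphD mulmxDl mulmxDr Fu Fv.
- by rewrite !rmorphM -!mulmxE (mulmxA F) Fu -[LHS]mulmxA Fv mulmxA.
Qed.

(** The counit axiom (epsilon (x) id) Delta = id, seen in matrices and checked on generators. *)
Lemma tensrep_triv n m (sigma : rep q m) w :
  tensrep (trivrep n) sigma w = 1%:M *t sigma w.
Proof.
move: w; apply: walg_ind => [|||c|u v Pu Pv|u v Pu Pv].
- by rewrite tensrepX /= /trivrep counitX.
- rewrite /tensrep [coprod _](wliftXV (coprod_rels q)).
  rewrite (tlift_pure (tensrep_bil _ _)) /= /trivrep.
  by rewrite [counit _](wliftXV (walg_counit_rels q)).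
- rewrite tensrepY /= /trivrep counitY raddf0.
  by rewrite tens0mx add0r.
- rewrite !linearZ /= !rmorph1.
  have := tensmxZZ 1 c (1%:M : 'M_n) (1%:M : 'M_m).
  by rewrite tensmx11 scale1r mul1r.
- by rewrite !rmorphD /= Pu Pv; apply/matrixP => i j; rewrite !mxE mulrDr.
- by rewrite !rmorphM /= Pu Pv -!mulmxE tensmx_mul mulmx1.
Qed.

End Generation.

(** * Relations between the matrices A, B, C and S *)

Section Clock.
Variables (R : realType) (N : nat).
Hypothesis oddN : odd N.
Local Notation C := R[i].
Local Notation q := (qN R N).
Local Notation A := (Amx R N).
Local Notation B := (Bmx R N).

Let N_gt0 : (0 < N)%N. Proof. exact: odd_gt0. Qed.

(** If q^(2k) = 1 then q^k = 1 or -1, so sin(k pi / N) = 0, impossible for 0 < k < N. *)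
Lemma qN2_prim : N.-primitive_root (q ^+ 2).
Proof.
have NR0 : (0 : R) < N%:R by rewrite ltr0n.
rewrite /primitive_root_of_unity N_gt0; apply/forallP => i.
rewrite unity_rootE -exprM; apply/eqP.
have [->|iN] := eqVneq i.+1 N; first by rewrite qN_exp2N // eqxx.
have {}iN : (i.+1 < N)%N by rewrite ltn_neqAle iN ltn_ord.
apply/negbTE; rewrite mulnC exprM sqrf_eq1 qN_exp.
have : 0 < sin (i.+1%:R * (pi / N%:R) : R).
  apply: sin_gt0_pi; apply/andP; split.
    by rewrite mulr_gt0 ?ltr0n // divr_gt0 ?pi_gt0.
  by rewrite mulrCA gtr_pMr ?pi_gt0 // ltr_pdivrMr // mul1r ltr_nat.
by rewrite !eq_complex /= oppr0 => /gt_eqF ->; rewrite !andbF.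
Qed.

Lemma iter_ordS n (j : 'I_N) : iter n (@ordS N) j = ((j + n) %% N)%N :> nat.
Proof.
elim: n => [|n IH] /=; first by rewrite addn0 modn_small.
by rewrite IH -addn1 modnDml addn1 addnS.
Qed.

Lemma BmxX n : B ^+ n = \matrix_(i, j) (i == iter n (@ordS N) j)%:R.
Proof.
elim: n => [|n IH]; first by apply/matrixP => i j; rewrite expr0 !mxE.
rewrite exprS IH -mulmxE; apply/matrixP => i j; rewrite !mxE.
rewrite (bigD1 (iter n (@ordS N) j)) //= big1 => [|k /negbTE kj].
  by rewrite !mxE eqxx mulr1 addr0.
by rewrite !mxE kj mulr0.
Qed.

Lemma BmxN : B ^+ N = 1.
Proof.
rewrite BmxX; apply/matrixP => i j; rewrite !mxE; congr (_ == _)%:R.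
by apply: val_inj; rewrite /= iter_ordS modnDr modn_small.
Qed.

Lemma Bmx_unit : B \in unitmx.
Proof.
have BB : B *m B ^+ N.-1 = 1%:M by rewrite mulmxE -exprS prednK // BmxN.
by have [] := mulmx1_unit BB.
Qed.

Lemma AmxX n : A ^+ n = diag_mx (\row_(k < N) (q ^+ (2 * k)) ^+ n).
Proof.
elim: n => [|n IH].
  by apply/matrixP => i j; rewrite expr0 !mxE.
rewrite exprS IH -mulmxE mul_diag_mx; apply/matrixP => i j; rewrite !mxE.
by case: eqP => [->|]; rewrite ?mulr0n ?mulr0 // !mulr1n -exprS.
Qed.

Lemma AmxN : A ^+ N = 1.
Proof.
rewrite AmxX; apply/matrixP => i j; rewrite !mxE.
by rewrite -exprM mulnAC exprM qN_exp2N // expr1n.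
Qed.

Lemma invBA : invmx B *m A = q ^+ 2 *: (A *m invmx B).
Proof.
apply: (canLR (mulKmx Bmx_unit)).
rewrite -scalemxAr mulmxA scalemxAl -AmxBmx.
by rewrite mulmxK // Bmx_unit.
Qed.

Lemma invmx_tens1 n (U : 'M[C]_N) : U \in unitmx ->
  invmx ((1%:M : 'M_n) *t U) = 1%:M *t invmx U.
Proof.
move=> Uu; have UV : (1%:M *t U) *m (1%:M *t invmx U) = 1%:M :> 'M_(n * N).
  by rewrite tensmx_mul mulmx1 mulmxV // tensmx11.
by rewrite -[invmx _]mulmx1 -UV mulKmx //; case: (mulmx1_unit UV).
Qed.

Definition Cmx : 'M[C]_(N * N) := B1mx R N *m A2mx R N *m invmx (B2mx R N).

Lemma CmxE : Cmx = B *t (A *m invmx B).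
Proof.
by rewrite /Cmx invmx_tens1 ?Bmx_unit // !tensmx_mul mulmx1 mul1mx mulmx1.
Qed.

(** Reordering (A B^-1)^N produces (q^2)^(N(N-1)/2), which is 1 since N is odd. *)
Lemma CmxN : Cmx ^+ N = 1.
Proof.
rewrite CmxE tensmxX BmxN (exprM_qcomm _ invBA) AmxN.
have -> : invmx B ^+ N = 1.
  have -> : invmx B = B ^+ N.-1.
    rewrite -[RHS](mulKmx Bmx_unit) mulmxE -exprS prednK // BmxN.
    by rewrite [RHS]mulr1.
  by rewrite -exprM mulnC exprM BmxN expr1n.
rewrite bin2odd // exprM (prim_expr_order qN2_prim) expr1n scale1r.
by rewrite mulmxE mulr1; apply: tensmx11.
Qed.

(** The factors q^2 from the B of the first slot and the B^-1 of the second cancel. *)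
Lemma Cmx_AA : Cmx *m (A *t A) = (A *t A) *m Cmx.
Proof.
rewrite CmxE !tensmx_mul -mulmxA invBA AmxBmx -scalemxAr.
have := tensmxZZ (q ^+ 2) 1 (B *m A) (A *m (A *m invmx B)).
have := tensmxZZ 1 (q ^+ 2) (B *m A) (A *m (A *m invmx B)).
by rewrite !scale1r mul1r mulr1 => -> ->.
Qed.

Lemma Cmx_B2 : Cmx *m B2mx R N = q ^+ 2 *: (B2mx R N *m Cmx).
Proof.
have Bu := Bmx_unit.
rewrite CmxE !tensmx_mul mulmx1 mul1mx -mulmxA mulVmx // mulmx1.
have := tensmxZZ 1 (q ^+ 2) B (B *m (A *m invmx B)).
by rewrite scale1r mul1r => <-; rewrite mulmxA scalemxAl -AmxBmx mulmxK.
Qed.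

(** Block form of S as a controlled shift, which reduces its relations to those of [B ^+ i]. *)
Lemma SmxE : Smx R N = \sum_(i < N) delta_mx i i *t B ^+ i.
Proof.
apply: eq_bigr => i _; rewrite -tensmx_sumr; congr (_ *t _).
rewrite BmxX [RHS]matrix_sum_delta exchange_big; apply: eq_bigr => j _ /=.
rewrite (bigD1 (iter i (@ordS N) j)) //= big1 => [|k /negbTE kj].
  by rewrite addr0 mxE eqxx scale1r.
by rewrite mxE kj scale0r.
Qed.

Lemma Smx_unit : Smx R N \in unitmx.
Proof.
suff SV : Smx R N *m (\sum_(i < N) delta_mx i i *t invmx (B ^+ i)) = 1%:M.
  by have [] := mulmx1_unit SV.
have BXu i : B ^+ i \in unitmx.
  elim: i => [|i IH]; first by rewrite expr0 unitmx1.
  by rewrite exprS -mulmxE unitmx_mul Bmx_unit.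
rewrite SmxE mulmx_suml -tensmx11 {1}mx1_sum_delta tensmx_suml.
apply: eq_bigr => i _; rewrite mulmx_sumr (bigD1 i) //= big1 => [|k /negbTE ki].
  by rewrite addr0 tensmx_mul mul_delta_mx mulmxV ?BXu.
by rewrite tensmx_mul mul_delta_mx_cond eq_sym ki mulr0n tens0mx.
Qed.

Lemma Smx_B2 : Smx R N *m B2mx R N = B2mx R N *m Smx R N.
Proof.
rewrite SmxE mulmx_suml mulmx_sumr; apply: eq_bigr => i _.
by rewrite !tensmx_mul mulmx1 mul1mx !mulmxE -exprSr -exprS.
Qed.

(** On block i, moving A past B^i gives q^(-2i), cancelled by the eigenvalue q^(2i) of A on e_i. *)
Lemma Smx_AA : Smx R N *m (A *t A) = A2mx R N *m Smx R N.
Proof.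
have q0 : q ^+ 2 != 0 by rewrite expf_neq0 ?qN_neq0.
have BA : B *m A = q ^- 2 *: (A *m B) by rewrite AmxBmx scalerA mulVf ?scale1r.
rewrite SmxE mulmx_suml mulmx_sumr; apply: eq_bigr => i _.
rewrite !tensmx_mul mul1mx (mulmx_qcommX _ BA).
have -> : delta_mx i i *m A = q ^+ (2 * i) *: delta_mx i i.
  rewrite mul_mx_diag; apply/matrixP => k j; rewrite !mxE.
  by have [->|_] := eqVneq j i; rewrite ?andbF ?mul0r ?mulr0 // mulrC.
by rewrite tensmxZZ exprVn -exprM mulfV ?scale1r // expf_neq0 ?qN_neq0.
Qed.

End Clock.

(** * The cyclic quantum dilogarithm of an operator of order N *)

Section Dilogarithm.
Variables (R : realType) (N : nat).
Hypothesis oddN : odd N.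
Local Notation C := R[i].
Local Notation q := (qN R N).
Variables (zeta : C -> C -> C) (a c : C) (n : nat) (M : 'M[C]_n).
Hypothesis acN : c ^+ N - a ^+ N = 1.
Hypothesis zeta_neq0 : zeta a c != 0.
Hypothesis MN : M ^+ N = 1.
Local Notation Phi := (qdilog N zeta a c M).
Local Notation w := (cqdilog N a c).

Let N_gt0 : (0 < N)%N. Proof. exact: odd_gt0. Qed.
Let qP := qN2_prim R oddN.

(** A zero factor would give c^N = a^N. *)
Lemma cqdilog_factor_neq0 j : c - a * q ^+ (2 * j) != 0.
Proof.
rewrite subr_eq0; apply/eqP => ca; have := acN.
rewrite ca exprMn -exprM mulnAC exprM qN_exp2N // expr1n mulr1 subrr.
by move/eqP; rewrite eq_sym oner_eq0.
Qed.

Lemma cqdilog_neq0 j : w j != 0.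
Proof.
rewrite prodf_seq_neq0; apply/allP => k _.
by rewrite invr_eq0 cqdilog_factor_neq0.
Qed.

Lemma cqdilogS j : w j.+1 * (c - a * q ^+ (2 * j.+1)) = w j.
Proof.
by rewrite {1}/cqdilog big_nat_recr //= divfK // cqdilog_factor_neq0.
Qed.

Lemma cqdilogN : w N = 1.
Proof.
rewrite /cqdilog -(big_morph _ (@invfM C) (@invr1 C)).
under eq_bigr do rewrite exprM.
by rewrite (prod_unity_root qP) acN invr1.
Qed.

(** [qdilog] is a choice with default 0, so a witness is needed: the spectral sum of the prescribed
    eigenvalues. *)
Lemma qdilog_specP : qdilog_spec N zeta a c M Phi.
Proof.
apply: xgetPex.
exists (\sum_(i < N) (zeta a c * w i) *: eigenproj N (q ^+ 2) M i).
move=> i v; rewrite exprM => Mv; rewrite mulmx_suml.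
have Pv (j : 'I_N) : (zeta a c * w j) *: eigenproj N (q ^+ 2) M j *m v
          = (zeta a c * w j * (j == i)%:R) *: v.
  by rewrite -scalemxAl (eigenproj_eigen qP j Mv) scalerA.
rewrite (eq_bigr _ (fun j _ => Pv j)) (bigD1 i) //= eqxx mulr1.
by rewrite big1 ?addr0 // => j /negbTE ->; rewrite mulr0 scale0r.
Qed.

(* [j = N] is allowed so that the shift by one needs no reduction mod [N]. *)
Lemma qdilogE j p (V : 'M_(n, p)) : (j <= N)%N ->
  M *m V = q ^+ (2 * j) *: V -> Phi *m V = (zeta a c * w j) *: V.
Proof.
have lt_case i : (i < N)%N ->
    M *m V = q ^+ (2 * i) *: V -> Phi *m V = (zeta a c * w i) *: V.
  move=> iN MV; apply/matrixP => r k.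
  have Mk : M *m col k V = q ^+ (2 * Ordinal iN) *: col k V.
    by rewrite colE mulmxA MV -scalemxAl.
  have := qdilog_specP Mk; rewrite colE mulmxA -!colE => /matrixP/(_ r 0).
  by rewrite !mxE.
rewrite leq_eqVlt => /orP[/eqP-> | /lt_case //].
rewrite qN_exp2N // cqdilogN => MV.
have := lt_case 0%N N_gt0; rewrite muln0 expr0 MV => -> //.
by rewrite /cqdilog big_geq.
Qed.

Lemma qdilog_unit : Phi \in unitmx.
Proof.
suff PV : Phi *m (\sum_(i < N) (zeta a c * w i)^-1 *: eigenproj N (q ^+ 2) M i)
  = 1%:M by have [] := mulmx1_unit PV.
rewrite mulmx_sumr -(sum_eigenproj qP M); apply: eq_bigr => i _.
have MP : M *m eigenproj N (q ^+ 2) M i =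
    q ^+ (2 * i) *: eigenproj N (q ^+ 2) M i.
  by rewrite exprM eigenprojP.
rewrite -scalemxAr (qdilogE (ltnW (ltn_ord i)) MP).
by rewrite scalerK // mulf_neq0 // cqdilog_neq0.
Qed.

Lemma qdilog_comm (T : 'M_n) : M *m T = T *m M -> Phi *m T = T *m Phi.
Proof.
move=> MT; apply: (eigen_ext qP MN) => i V; rewrite -exprM => MV.
have MTV : M *m (T *m V) = q ^+ (2 * i) *: (T *m V).
  by rewrite mulmxA MT -mulmxA MV scalemxAr.
rewrite -!mulmxA (qdilogE (ltnW (ltn_ord i)) MTV).
by rewrite (qdilogE (ltnW (ltn_ord i)) MV) scalemxAr.
Qed.

Lemma qdilog_shift (T : 'M_n) : M *m T = q ^+ 2 *: (T *m M) ->
  Phi *m ((c%:M - a *: M) *m T) = T *m Phi.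
Proof.
move=> MT; apply: (eigen_ext qP MN) => i V; rewrite -exprM => MV.
have MTV : M *m (T *m V) = q ^+ (2 * i.+1) *: (T *m V).
  rewrite mulmxA MT -scalemxAl -mulmxA MV -scalemxAr scalerA -exprD.
  by rewrite mulnS.
rewrite -!mulmxA (qdilogE (ltnW (ltn_ord i)) MV) mulmxBl mul_scalar_mx.
rewrite -scalemxAl MTV scalerA -scalerBl -scalemxAr.
(* The index [i.+1] may equal N here, the wrap-around case. *)
rewrite (qdilogE (ltn_ord i) MTV) scalerA -scalemxAr; congr (_ *: _).
by rewrite -(cqdilogS i) mulrC mulrA.
Qed.

End Dilogarithm.

(** * The root defect and the intertwining property *)

Section Intertwiner.
Variables (R : realType) (N : nat).
Hypothesis oddN : odd N.
Local Notation C := R[i].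
Local Notation q := (qN R N).
Variable rt : nth_root R N.

(** The [pick] succeeds: the ratio of the two roots is an N-th root of unity, hence a power of
    q^2. *)
Lemma root_defectE (z w : C) : z != 0 -> w != 0 ->
  rt (z * w) = q ^+ (2 * root_defect rt z w) * rt z * rt w.
Proof.
move=> z0 w0; rewrite /root_defect; case: pickP => [m /eqP //|no].
have rzw : rt z * rt w != 0 by rewrite mulf_neq0 ?nroot_neq0.
have : (rt (z * w) / (rt z * rt w)) ^+ N = 1.
  by rewrite expr_div_n exprMn !nrootX ?mulf_neq0 // divff // mulf_neq0.
case/(prim_rootP (qN2_prim R oddN)) => m Em; have /eqP[] := no m.
by rewrite exprM -Em -mulrA divfK.
Qed.

End Intertwiner.

Theorem proposition2p21 (R : realType) (N : nat) (oddN : odd N)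
    (rt : nth_root R N) (zeta : R[i] -> R[i] -> R[i])
    (zeta_neq0 : forall a c : R[i], c ^+ N - a ^+ N = 1 -> zeta a c != 0)
    (l l' : weight R) (hl : nonsingular l) (hl' : nonsingular l')
    (hreg : regular oddN rt hl hl') :
  let F := Fmx rt zeta l l' in
  let VV' := tensrep (Vrep oddN rt hl) (Vrep oddN rt hl') in
  let Vll' := Vrep oddN rt (regular_nonsingular hreg) in
  [/\ F \in unitmx,
      intertwines VV' (tensrep (trivrep N) Vll') F
    & forall (w : walg (qN R N)) (v v' : 'cV_N),
        F *m (VV' w *m (v *t v')) = (1%:M *t Vll' w) *m (F *m (v *t v'))].
Proof.
move=> F VV' Vll'.
have [/andP[x0 y0] /andP[x'0 y'0]] := (hl, hl').
have /andP[/= _ s0] := regular_nonsingular hreg.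
set A := Amx R N; set B := Bmx R N; set q := qN R N.
pose s := rt (l.2 * l'.1 + l'.2); pose a := - (rt l.2 * rt l'.1 / s).
pose c := rt l'.2 / s; pose m := root_defect rt l.1 l'.1.
pose Phi := qdilog N zeta a c (Cmx R N).
have FE : F = invmx (B2mx R N) ^+ m *m (Smx R N *m Phi).
  by rewrite /F /Phi /m /a /c /s; case: (l) (l') => [? ?] [].
have rs0 : s != 0 by exact: nroot_neq0.
have acN : c ^+ N - a ^+ N = 1.
  rewrite /c /a exprNn -signr_odd oddN expr1 mulN1r opprK !expr_div_n exprMn.
  by rewrite !nrootX // -mulrDl addrC divff.
have CN := CmxN R oddN; have z0 := zeta_neq0 _ _ acN.
have B2u : B2mx R N \in unitmx.
  by rewrite tensmx_unit ?unitmx1 ?Bmx_unit // -lt0n odd_gt0.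
have Fint : intertwines VV' (tensrep (trivrep N) Vll') F.
  apply: intertwines_gen.
    rewrite /= tensrep_triv tensrepX !VrepX FE tensmxZZ.
    rewrite -[LHS]scalemxAr -mulmxA -mulmxA qdilog_comm ?Cmx_AA //.
    rewrite (mulmxA (Smx R N)) Smx_AA -[A2mx R N *m _ *m _]mulmxA.
    rewrite (mulmxA (_ ^+ m)).
    (* Moving A_2 past B_2^(-m) produces q^(2m), exactly the ratio of (x x')^(1/N) to x^(1/N)
       x'^(1/N). *)
    have B2A : invmx (B2mx R N) *m A2mx R N
             = q ^+ 2 *: (A2mx R N *m invmx (B2mx R N)).
      rewrite invmx_tens1 ?Bmx_unit // !tensmx_mul mulmx1 invBA //.
      by have := tensmxZZ 1 (q ^+ 2) (1%:M : 'M_N) (A *m invmx B);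
        rewrite scale1r mul1r.
    rewrite (mulmx_qcommX _ B2A) -exprM -scalemxAl scalerA -mulmxA.
    have := tensmxZZ 1 (rt (l.1 * l'.1)) (1%:M : 'M_N) A.
    rewrite scale1r mul1r => ->; rewrite -scalemxAl; congr (_ *: _).
    by rewrite (root_defectE oddN) // mulrC !mulrA.
  rewrite /= tensrep_triv tensrepY !VrepX !VrepY FE.
  (* Since C B_2 = B_1 A_2, the two terms of Delta(Y) are - s a C B_2 and s c B_2. *)
  have -> : (rt l.2 *: B) *t (rt l'.1 *: A) + 1%:M *t (rt l'.2 *: B)
          = s *: ((c%:M - a *: Cmx R N) *m B2mx R N).
    have := tensmxZZ 1 (rt l'.2) (1%:M : 'M_N) B; rewrite scale1r mul1r => ->.
    rewrite tensmxZZ mulmxBl mul_scalar_mx -scalemxAl -scaleNr scalerDr.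
    rewrite !scalerA.
    rewrite /Cmx (mulmxKV B2u) tensmx_mul mulmx1 mul1mx [LHS]addrC.
    by congr (_ *: _ + _ *: _); rewrite /c /a ?opprK [s * _]mulrC divfK.
  have -> : 1%:M *t (rt (weight_mul l l').2 *: B) = s *: B2mx R N.
    by have := tensmxZZ 1 s (1%:M : 'M_N) B; rewrite scale1r mul1r.
  have iB : invmx (B2mx R N) *m B2mx R N = 1 *: (B2mx R N *m invmx (B2mx R N)).
    by rewrite scale1r mulmxV // mulVmx.
  have iBX : invmx (B2mx R N) ^+ m *m B2mx R N
           = B2mx R N *m invmx (B2mx R N) ^+ m.
    by rewrite (mulmx_qcommX _ iB) expr1n scale1r.
  rewrite -[LHS]scalemxAr -[RHS]scalemxAl; congr (_ *: _).
  rewrite -[LHS]mulmxA -(mulmxA (Smx R N)) qdilog_shift ?Cmx_B2 //.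
  rewrite (mulmxA (Smx R N)) Smx_B2 -[B2mx R N *m _ *m _]mulmxA.
  by rewrite (mulmxA (_ ^+ m)) iBX -[LHS]mulmxA.
split=> //.
  rewrite FE unitmx_mul [_ *m Phi \in _]unitmx_mul Smx_unit //.
  rewrite qdilog_unit // !andbT.
  elim: m {FE} => [|k IH]; first by rewrite expr0 unitmx1.
  by rewrite exprS -mulmxE unitmx_mul unitmx_inv B2u.
by move=> w v v'; rewrite mulmxA Fint /= tensrep_triv -mulmxA.
Qed.
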